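(* Let $T$ be a complete first-order theory with monster model $\mathfrak{C}$, $A\subseteq\mathfrak{C}$ a small set and $\alpha$ a small ordinal (no countability is assumed). Suppose that: (1) $X\subseteq\mathfrak{C}^\alpha$ is type definable over $A$. (2) $E$ is a pseudo $F_\sigma$, $\emptyset$-invariant equivalence relation on $X$ with normal form $\langle U_n\mid n<\omega\rangle$, and $E$ is bounded on $X$. (3) $C\subseteq X$ is an $E$-class, and $E\upharpoonright C$ is not strongly closed with respect to $\langle U_n\mid n<\omega\rangle$, i.e. there is no $n<\omega$ with $E\cap C^2=U_n\cap C^2$. (4) $C\subseteq Y\subseteq X$, where $Y$ is pseudo closed and $\Gamma$-invariant. (5) $\Gamma\leq\operatorname{Aut}(\mathfrak{C})$ is $C$-transitive (for all $a,b\in C$ there is $\sigma\in\Gamma$ with $\sigma(a)=b$), and for every $\sigma\in\Gamma$ there is some $n<\omega$ such that $(c,\sigma(c))\in U_n$ for all $c\in C$. Then $E\upharpoonright Y$ has at least $2^{\aleph_0}$ classes.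
   Context: $\mathfrak{C}$ is a monster model of $T$: $\kappa$-saturated and $\kappa$-homogeneous for a big cardinal $\kappa$ (in particular $\kappa$ is much larger than the size of the language). ''Small'' means of cardinality $<\kappa$; all parameter sets and models ($M\prec\mathfrak{C}$) are small. A subset of $\mathfrak{C}^\alpha$ is pseudo closed if it is type definable over some small set, and pseudo $F_\sigma$ if it is a countable union of pseudo closed sets. A set is $\emptyset$-invariant if it is invariant under $\operatorname{Aut}(\mathfrak{C})$. An $\emptyset$-invariant pseudo $F_\sigma$ equivalence relation on $X$ means an $\emptyset$-invariant pseudo $F_\sigma$ set $E\subseteq\mathfrak{C}^\alpha\times\mathfrak{C}^\alpha$ whose restriction to $X$ is an equivalence relation; it is bounded if $|X/E|<\kappa$. A normal form is a sequence of $\emptyset$-type definable sets $U_n\subseteq\mathfrak{C}^\alpha\times\mathfrak{C}^\alpha$ with $E=\bigcup_{n<\omega}U_n$, such that $U_0$ contains the diagonal of $X$, each $U_n$ is symmetric, and for all $a,b,c\in X$, $(a,c),(c,b)\in U_n$ implies $(a,b)\in U_{n+1}$. *)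

(* Defs.v *)
From mathcomp Require Import all_boot.
From mathcomp Require Import boolp classical_sets functions cardinality.
From mathcomp Require Import wochoice.

Set Implicit Arguments.
Unset Strict Implicit.
Unset Printing Implicit Defensive.

Local Open Scope classical_set_scope.
Local Open Scope card_scope.

(* A cardinal kappa is represented by any type K of that cardinality, and an
   ordinal by a well-ordered type. *)

Definition small (K T : Type) (A : set T) : Prop :=
  (A #<= [set: K]) /\ ~ ([set: K] #<= A).
Arguments small K {T} A.

Record ordinalType := OrdinalType {
  ord_sort :> Type;
  ord_le : rel ord_sort;
  ord_le_wo : well_order ord_le
}.

Record language := Language {
  func : Type;
  func_arity : func -> nat;
  pred_sym : Type;
  pred_arity : pred_sym -> nat
}.

(* Formulas have their free variables in an arbitrary type V; the variable
   bound by Fall is None. *)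

Inductive term (L : language) (V : Type) : Type :=
| Tvar of V
| Tfun (f : func L) of ('I_(func_arity f) -> term L V).
Arguments Tvar {L V}.
Arguments Tfun {L V}.

Inductive formula (L : language) (V : Type) : Type :=
| Fbot
| Feq of term L V & term L V
| Frel (r : pred_sym L) of ('I_(pred_arity r) -> term L V)
| Fimp of formula L V & formula L V
| Fall of formula L (option V).
Arguments Fbot {L V}.
Arguments Feq {L V}.
Arguments Frel {L V}.
Arguments Fimp {L V}.
Arguments Fall {L V}.

Definition Fnot (L : language) (V : Type) (phi : formula L V) := Fimp phi Fbot.

Record structure (L : language) := Structure {
  carrier :> Type;
  carrier_inhabited : inhabited carrier;
  func_interp : forall f : func L, ('I_(func_arity f) -> carrier) -> carrier;
  pred_interp : forall r : pred_sym L, ('I_(pred_arity r) -> carrier) -> Prop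
}.

Fixpoint eval (L : language) (M : structure L) (V : Type) (v : V -> M)
    (t : term L V) : M :=
  match t with
  | Tvar x => v x
  | Tfun f ts => func_interp (fun i => eval v (ts i))
  end.

Fixpoint sat (L : language) (M : structure L) (V : Type) (v : V -> M)
    (phi : formula L V) : Prop :=
  match phi with
  | Fbot => False
  | Feq t u => eval v t = eval v u
  | Frel r ts => pred_interp (fun i => eval v (ts i))
  | Fimp phi psi => sat v phi -> sat v psi
  | Fall phi =>
      forall a : M, sat (fun o => if o is Some x then v x else a) phi
  end.

Definition models (L : language) (M : structure L) (T : set (formula L void)) :=
  forall phi, T phi -> sat (of_void M) phi.

Definition entails (L : language) (T : set (formula L void))
    (phi : formula L void) :=
  forall M : structure L, models M T -> sat (of_void M) phi.

Definition complete_theory (L : language) (T : set (formula L void)) :=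
  (exists M : structure L, models M T) /\
  forall phi, entails T phi \/ entails T (Fnot phi).

Section Model.
Variables (L : language) (M : structure L).

(* L(A)-formulas with variables in V are terms of type formula L (V + A). *)
Definition sat_param (A : set M) (V : Type) (v : V -> M)
    (phi : formula L (V + A)) : Prop :=
  sat (fun z : V + A => match z with inl x => v x | inr a => \val a end) phi.

Definition saturated (K : Type) :=
  forall (A : set M) (p : set (formula L (unit + A))),
    small K A ->
    (forall q, q `<=` p -> finite_set q ->
       exists a : M, forall phi, q phi -> sat_param (fun=> a) phi) ->
    exists a : M, forall phi, p phi -> sat_param (fun=> a) phi.

Definition automorphism (s : M -> M) :=
  [/\ bijective s,
      forall (f : func L) xs,
        s (func_interp (f := f) xs) = func_interp (s \o xs)
    & forall (r : pred_sym L) xs,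
        pred_interp (r := r) (s \o xs) <-> pred_interp xs].

Definition elementary_map (A : set M) (f : A -> M) :=
  forall phi : formula L A, sat (fun a : A => \val a) phi <-> sat f phi.

(* Homogeneity in the sense customary for monster models (also called strong
   homogeneity): the extension is an automorphism. *)
Definition homogeneous (K : Type) :=
  forall (A : set M) (f : A -> M), small K A -> elementary_map f ->
    exists2 s, automorphism s & forall a : A, s (\val a) = f a.

(* Of the size of kappa we only require |L| + aleph_0 < kappa. *)
Definition monster (K : Type) (T : set (formula L void)) :=
  [/\ models M T,
      [/\ small K [set: nat], small K [set: func L] & small K [set: pred_sym L]],
      saturated K & homogeneous K].

Definition aut_subgroup (G : set (M -> M)) :=
  [/\ forall s, G s -> automorphism s,
      G id,
      forall s t, G s -> G t -> G (s \o t)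
    & forall s, G s -> exists2 t, G t & cancel s t /\ cancel t s].

Definition type_definable (A : set M) (J : Type) (D : set (J -> M)) :=
  exists p : set (formula L (J + A)),
    D = [set x | forall phi, p phi -> sat_param x phi].

Definition pseudo_closed (K J : Type) (D : set (J -> M)) :=
  exists2 A : set M, small K A & type_definable A D.

Definition pseudo_Fsigma (K J : Type) (D : set (J -> M)) :=
  exists2 F : nat -> set (J -> M),
    (forall n, pseudo_closed K (F n)) & D = \bigcup_n F n.

Definition invariant_under (G : set (M -> M)) (J : Type) (D : set (J -> M)) :=
  forall s x, G s -> D (s \o x) <-> D x.

(* The identification of M^J x M^J with M^(J + J). *)
Definition flat (J : Type) (D : set ((J -> M) * (J -> M))) : set (J + J -> M) :=
  [set z : J + J -> M | D (z \o inl, z \o inr)].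

Section Relation.
Variables (J : Type) (X : set (J -> M)) (E : set ((J -> M) * (J -> M))).

Definition equivalence_on :=
  [/\ forall a, X a -> E (a, a),
      forall a b, X a -> X b -> E (a, b) -> E (b, a)
    & forall a b c, X a -> X b -> X c -> E (a, b) -> E (b, c) -> E (a, c)].

Definition class_of (a : J -> M) : set (J -> M) := [set b | X b /\ E (a, b)].

Definition quotient : set (set (J -> M)) := class_of @` X.

Definition normal_form (U : nat -> set ((J -> M) * (J -> M))) :=
  [/\ forall n, type_definable set0 (flat (U n)),
      E = \bigcup_n U n,
      forall a, X a -> U 0 (a, a),
      forall n a b, U n (a, b) -> U n (b, a)
    & forall n a b c, X a -> X b -> X c ->
        U n (a, c) -> U n (c, b) -> U n.+1 (a, b)].

Definition strongly_closed_on (C : set (J -> M))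
    (U : nat -> set ((J -> M) * (J -> M))) :=
  exists n, E `&` (C `*` C) = U n `&` (C `*` C).

End Relation.

Definition invariant_Fsigma_equivalence (K J : Type) (X : set (J -> M))
    (E : set ((J -> M) * (J -> M))) :=
  [/\ pseudo_Fsigma K (flat E), invariant_under automorphism (flat E)
    & equivalence_on X E].

Definition bounded (K J : Type) (X : set (J -> M))
    (E : set ((J -> M) * (J -> M))) := small K (quotient X E).

Definition transitive_on (J : Type) (G : set (M -> M)) (C : set (J -> M)) :=
  forall a b, C a -> C b -> exists2 s, G s & s \o a = b.

End Model.

(* Main.v *)
(* Call a 0-definable relation containing [U m] a neighbourhood of order [m], and
   fix a maximal proper Gamma-invariant ideal of subsets of [C] (the dual of a
   minimal closed invariant set of types in the closure of [C]). As [E] is bounded,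
   each positive set [V] has a point [c] of [Y] and an [m] such that [V `&` D c] is
   positive for all [D] of order [m].

   If some positive set were concentrated near one point [c] of [Y], that is,
   [V `\` D c] null for all [D] of some order, then finitely many translates of
   [V] cover [C] up to a null set, so [C] itself is concentrated near [c]. Some
   point of [C] lies near [c] and [Gamma] is transitive on [C], so [C] is
   concentrated near each of its own points at a fixed order, and [C `*` C] lies in
   one [U n]: [E] is strongly closed on [C].

   Hence any two positive sets can be shrunk to positive definable ones whose
   product avoids a given [U n] on [Y]. The resulting Cantor scheme and compactness
   give [2 ^ aleph_0] pairwise inequivalent points of [Y]. *)
Require Import Defs.
From mathcomp Require Import all_boot.
From mathcomp Require Import boolp classical_sets functions cardinality.

Local Open Scope classical_set_scope.
Local Open Scope card_scope.

Set Implicit Arguments.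
Unset Strict Implicit.
Unset Printing Implicit Defensive.

(** * Cardinals *)

Lemma card_le_inj (T U : Type) (A : set T) (B : set U) (f : T -> U) :
  set_fun A B f -> set_inj A f -> A #<= B.
Proof.
move=> fAB finj; have /injfunPex[g] : exists2 f, set_fun A B f & set_inj A f.
  by exists f.
exact: inj_card_le g.
Qed.

Lemma Zorn_maximal (T : Type) (P : set (set T)) :
  (forall F : set (set T), F `<=` P -> total_on F subset ->
    P (\bigcup_(A in F) A)) ->
  exists2 A, P A & forall B, A `<=` B -> P B -> B `<=` A.
Proof.
move=> /Zorn_bigcup[A [PA maxA]]; exists A => // B AB PB.
by apply: contrapT => NBA; apply: (maxA B).
Qed.

(** [P] singles out the graphs of partial injections. A maximal one is total or onto, since
    otherwise a free pair could be added to it. *)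
Lemma card_le_total (T U : Type) :
  [set: T] #<= [set: U] \/ [set: U] #<= [set: T].
Proof.
pose P (R : set (T * U)) :=
  forall p q, R p -> R q -> p.1 = q.1 <-> p.2 = q.2.
have [|R PR maxR] := @Zorn_maximal _ P.
  move=> F FP Ftot p q [R FR Rp] [S FS Sq].
  case: (Ftot _ _ FR FS) => [/(_ _ Rp) Sp|/(_ _ Sq) Rq].
    exact: FP FS _ _ Sp Sq.
  exact: FP FR _ _ Rp Rq.
have [tot|/existsNP[t /forallNP Nt]] := pselect (forall t, exists u, R (t, u)).
  left; case: (choice tot) => f Rf.
  apply: (@card_le_inj _ _ _ _ f) => // x y _ _ fxy.
  by apply: (PR _ _ (Rf x) (Rf y)).2.
have [tot|/existsNP[u /forallNP Nu]] := pselect (forall u, exists t, R (t, u)).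
  right; case: (choice tot) => f Rf.
  apply: (@card_le_inj _ _ _ _ f) => // x y _ _ fxy.
  by apply: (PR _ _ (Rf x) (Rf y)).1.
exfalso; apply: (Nt u).
apply: (maxR (R `|` [set (t, u)])); [by left| |by right].
move=> p q [Rp|->] [Rq|->] //=; first exact: PR.
- case: p Rp => x y /= Rp; split=> eq; move: Rp; rewrite eq => Rp.
    by case: (Nt _ Rp).
  by case: (Nu _ Rp).
- case: q Rq => x y /= Rp; split=> eq; move: Rp; rewrite -eq => Rp.
    by case: (Nt _ Rp).
  by case: (Nu _ Rp).
Qed.

(* A maximal family of pairwise disjoint injective sequences covers [T] up to a
   finite set. *)
Lemma card_mul_nat (T : Type) :
  infinite_set [set: T] -> [set: T * nat] #<= [set: T].
Proof.
move=> Tinf.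
pose P (S : set (nat -> T)) :=
  forall s t i j, S s -> S t -> s i = t j -> s = t /\ i = j.
have [|S PS maxS] := @Zorn_maximal _ P.
  move=> F FP Ftot s t i j [A FA As] [B FB Bt].
  case: (Ftot _ _ FA FB) => [/(_ _ As) Bs|/(_ _ Bt) At].
    exact: FP FB _ _ _ _ Bs Bt.
  exact: FP FA _ _ _ _ As At.
pose U := [set t | exists s i, S s /\ t = s i].
have Rfin : finite_set (~` U).
  apply: contrapT => /infiniteP /card_leP[f0].
  pose f n : T := \val (f0 (SigSub (mem_set (I : [set: nat] n)))).
  have fU n : ~ U (f n) by apply: set_mem (valP (f0 _)).
  have finj : injective f.
    by move=> i j /val_inj /inj; rewrite !inE => /(_ I I) /(congr1 \val).
  suff Sf : S f by apply: (fU 0); exists f, 0.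
  apply: (maxS (S `|` [set f])); [by left| |by right].
  move=> s t i j [Ss|->] [St|->]; first exact: PS.
  - by move=> e; case: (fU j); exists s, i.
  - by move=> e; case: (fU i); exists t, j.
  - by move=> /finj.
have [s0 Ss0] : exists s0, S s0.
  apply: contrapT => /forallNP NS; apply: Tinf; apply: sub_finite_set Rfin.
  by move=> t _ [s [i [Ss _]]]; case: (NS s).
have /countable_injP[r rinj] := finite_set_countable Rfin.
(* [e] codes [t] by a sequence of [S] and an index: even indices for the points covered by [S], odd
   indices along [s0] for the finitely many others. *)
have e_ex t : exists p : (nat -> T) * nat, S p.1 /\
   ((U t /\ ~~ odd p.2 /\ t = p.1 p.2./2) \/
    (~ U t /\ p = (s0, (r t).*2.+1))).
  have [Ut|NUt] := pselect (U t).
    have [s [i [Ss ti]]] := Ut; exists (s, i.*2); split=> //; left.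
    by rewrite /= odd_double doubleK.
  by exists (s0, (r t).*2.+1); split=> //; right.
have [e eP] := choice e_ex.
have einj : injective e.
  move=> t t'; have [_ [[_ [od te]]|[NUt te]]] := eP t;
    have [_ [[_ [od' te']]|[NUt' te']]] := eP t' => ee.
  - by rewrite te ee -te'.
  - by move: od; rewrite ee te' /= odd_double.
  - by move: od'; rewrite -ee te /= odd_double.
  - by move: ee; rewrite te te' => -[] /double_inj; apply: rinj; exact: mem_set.
(* Each sequence has room for pairs: its value at the code of (index of [t], [n]) determines both
   [t] and [n]. *)
pose h (p : T * nat) : T := (e p.1).1 (pickle ((e p.1).2, p.2)).
apply: (@card_le_inj _ _ _ _ h) => // -[t n] [t' n'] _ _ hE.
have [e1 /(pcan_inj pickleK)[e2 ->]] := PS _ _ _ _ (eP t).1 (eP t').1 hE.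
by congr pair; apply: einj; rewrite [e t]surjective_pairing e1 e2 -surjective_pairing.
Qed.

Section Small.
Variable K : Type.
Hypothesis natK : small K [set: nat].

Lemma small_le (T U : Type) (A : set T) (B : set U) :
  A #<= B -> small K B -> small K A.
Proof.
move=> AB [BK NKB]; split; first exact: card_le_trans BK.
by move=> KA; apply: NKB; apply: card_le_trans AB.
Qed.

Lemma small_countable (T : Type) (A : set T) : countable A -> small K A.
Proof. by move=> Ac; apply: small_le natK. Qed.

Lemma small_mul_nat (T : Type) : small K [set: T] -> small K [set: T * nat].
Proof.
move=> Ts; have [Tfin|Tinf] := pselect (finite_set [set: T]).
  apply: small_countable.
  have -> : [set: T * nat] = [set: T] `*` [set: nat] by apply/seteqP.
  by apply: countableX; [exact: finite_set_countable|exact: countableP].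
exact: small_le (card_mul_nat Tinf) Ts.
Qed.

(** [K] may be singular, so a small union of small sets can fail to be small. With countable pieces
    a point is coded by an index and a natural number. *)
Lemma small_bigcup (I T : Type) (F : I -> set T) :
  small K [set: I] -> (forall i, countable (F i)) -> small K (\bigcup_i F i).
Proof.
move=> /small_mul_nat Is Fc.
have /choice[r rinj] i : exists r : T -> nat, {in F i &, injective r}.
  exact/countable_injP.
have /choice[g gP] x : exists p : option (I * nat), (\bigcup_i F i) x ->
    exists2 i, F i x & p = Some (i, r i x).
  have [[i _ Fx]|N] := pselect ((\bigcup_i F i) x); last by exists None.
  by exists (Some (i, r i x)) => _; exists i.
apply: small_le Is.
apply: (card_le_trans (B := range (@Some (I * nat)))); last first.
  exact: card_image_le.
apply: (@card_le_inj _ _ _ _ g); first by move=> x /gP[i _ ->].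
move=> x y; rewrite !inE => /[dup] Ux /gP[i Fx ->] /gP[j Fy ->] [ij].
by rewrite -ij in Fy * => /rinj; apply; apply: mem_set.
Qed.

(** With [A] the smaller set, an injection of [A] into [B] attaches at most one point of [A] to each
    point of [B], so the union splits into finite pieces indexed by [B]. *)
Lemma small_setU (T : Type) (A B : set T) :
  small K A -> small K B -> small K (A `|` B).
Proof.
wlog AB : A B / A #<= B => [wlg|] As Bs.
  have := card_le_total A B.
  rewrite !(card_le_eql (card_setT _)) !(card_le_eqr (card_setT _)).
  by case=> /wlg; [|rewrite setUC]; apply.
have /card_leP[f] := AB.
have finj : injective f by move=> x y /inj; rewrite !inE; apply.
pose F (b : B) := [set \val b] `|` [set \val a | a in [set a | f a = b]].
have -> : A `|` B = \bigcup_b F b.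
  apply/seteqP; split=> [x [Ax|Bx]|x [b _ [->|[a _ <-]]]].
  - by exists (f (SigSub (mem_set Ax))) => //; right; exists (SigSub (mem_set Ax)).
  - by exists (SigSub (mem_set Bx)) => //; left.
  - by right; apply: set_mem (valP b).
  - by left; apply: set_mem (valP a).
apply: small_bigcup => [|b].
  by apply: small_le Bs; have /card_eqPle[] := card_setT B.
apply: finite_set_countable; rewrite finite_setU; split=> //.
apply: finite_image; have [[a fa]|N] := pselect (exists a, f a = b).
  apply: sub_finite_set (finite_set1 a) => a' /= fa'.
  by apply: finj; rewrite fa.
by apply: sub_finite_set (finite_set0 _) => a fa; apply: N; exists a.
Qed.

Lemma small_image (T U : Type) (f : T -> U) (A : set T) :
  small K A -> small K (f @` A).
Proof. by apply: small_le; exact: card_image_le. Qed.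

Lemma small_sum (T U : Type) :
  small K [set: T] -> small K [set: U] -> small K [set: T + U].
Proof.
move=> /(small_image inl) Ts /(small_image inr) Us.
apply: small_le (small_setU (Ts _) (Us _)).
by apply: subset_card_le => -[t|u] _; [left|right].
Qed.

End Small.

(** * Invariant ideals and the Cantor scheme *)

Section MaximalIdeal.
Variables (T : Type) (C : set T) (G : set (T -> T)).
Hypotheses (C0 : C !=set0) (Gid : G id)
  (GM : forall s t, G s -> G t -> G (s \o t))
  (GC : forall s c, G s -> C c -> C (s c)).

(** The ideal generated by [I], sets being compared through their traces on [C]. A derivation is a
    finite cover, so arguments about finitely many translates become inductions. *)
Inductive null (I : set (set T)) : set T -> Prop :=
| null_disjoint V of C `&` V `<=` set0 : null I V
| null_gen V of I V : null I V
| null_setU V W Z of null I V & null I W & C `&` Z `<=` V `|` W : null I Z.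

Lemma null_le I V W : null I W -> C `&` V `<=` W -> null I V.
Proof. by move=> IW VW; apply: (null_setU IW (W := W)) => // x /VW; left. Qed.

Definition invariant_family (I : set (set T)) :=
  forall s V, G s -> I V -> I (s @^-1` V).

Lemma null_preimage I s V :
  invariant_family I -> G s -> null I V -> null I (s @^-1` V).
Proof.
move=> Iinv Gs; elim=> {V} [V CV|V IV|V W Z _ IV _ IW ZVW].
- by apply: null_disjoint => x [Cx Vx]; apply: (CV (s x)); split=> //; exact: GC.
- exact/null_gen/Iinv.
- by apply: null_setU IV IW _ => x [Cx Zx]; apply: ZVW; split=> //; exact: GC.
Qed.

(** A derivation uses finitely many generators, which lie in one member of the chain; the first
    alternative is for derivations without generators. *)
Lemma null_chain (F : set (set (set T))) V : total_on F subset ->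
  null (\bigcup_(I in F) I) V -> C `&` V `<=` set0 \/ exists2 I, F I & null I V.
Proof.
move=> Ftot; elim=> {V} [V|V [I FI IV]|V W Z _ IV _ IW ZVW]; first by left.
  by right; exists I => //; exact: null_gen.
have mono I I' X : I `<=` I' -> null I X -> null I' X.
  move=> II'; elim=> {X} [X|X /II'|X X' X'' _ h _ h'].
  - exact: null_disjoint.
  - exact: null_gen.
  - exact: null_setU.
case: IV IW => [V0|[I FI IV]] [W0|[I' FI' IW]].
- by left=> x [Cx Zx]; case: (ZVW x) => // [/(conj Cx)/V0|/(conj Cx)/W0].
- right; exists I' => //; apply: null_setU IW ZVW; exact: null_disjoint.
- right; exists I => //; apply: null_setU IV _ ZVW; exact: null_disjoint.
- right; case: (Ftot _ _ FI FI') => [/mono h|/mono h].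
    by exists I' => //; apply: null_setU ZVW => //; exact: h.
  by exists I => //; apply: null_setU ZVW => //; exact: h.
Qed.

(** Zorn's lemma on the invariant families that generate a proper ideal. If adding the translates of
    [V] kept [C] positive, maximality would put [V], its own translate by [id], into [I]. *)
Lemma maximal_invariant_ideal : exists I,
  [/\ invariant_family I, ~ null I C &
      forall V, ~ null I V ->
        null (I `|` [set W | exists2 s, G s & W = s @^-1` V]) C].
Proof.
have [|I [Iinv NI] maxI] :=
    @Zorn_maximal _ [set I | invariant_family I /\ ~ null I C].
  move=> F FP Ftot; split=> [s V Gs [I FI IV]|].
    by exists I => //; apply: (FP _ FI).1.
  move=> /(null_chain Ftot)[C'|[I /FP[_]]] //.
  by have [c Cc] := C0; apply: (C' c).
exists I; split=> // V NV; apply: contrapT => NJ; apply/NV/null_gen.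
apply: maxI (I `|` [set W | exists2 s, G s & W = s @^-1` V]) _ _ _ _.
- by left.
- split=> // s W Gs [IW|[t Gt ->]]; first by left; exact: Iinv.
  by right; exists (t \o s) => //; exact: GM.
- by right; exists id.
Qed.

End MaximalIdeal.

(** * The Cantor scheme of positive definable sets *)

Section CantorScheme.
Variables (T : Type) (Y : set T) (U : nat -> T -> T -> Prop).
Variables (def : set (set T)) (pos : set (set T)).
Hypotheses (defT : def setT) (posT : pos setT).
Hypothesis pos_split : forall V W n, def V -> def W -> pos V -> pos W ->
  exists V' W', [/\ def V' /\ def W', pos V' /\ pos W', V' `<=` V /\ W' `<=` W
    & forall x y, Y x -> Y y -> V' x -> W' y -> ~ U n x y].
Hypothesis posI : forall V, pos V -> Y `&` V !=set0.
Hypothesis pos_compact : forall W : nat -> set T, (forall n, def (W n)) ->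
  (forall n, W n.+1 `<=` W n) -> (forall n, Y `&` W n !=set0) ->
  exists2 x, Y x & forall n, W n x.
Hypothesis U_mono : forall n x y, Y x -> Y y -> U n x y -> U n.+1 x y.

(** The pairs of [l] are treated one at a time by [pos_split]; later shrinking keeps the separations
    already obtained. *)
Lemma separate (I : eqType) (V : I -> set T) n (l : seq (I * I)) :
  (forall i, def (V i)) -> (forall i, pos (V i)) ->
  exists V' : I -> set T,
    [/\ forall i, def (V' i), forall i, pos (V' i), forall i, V' i `<=` V i
      & forall i j x y, (i, j) \in l -> i != j -> Y x -> Y y ->
          V' i x -> V' j y -> ~ U n x y].
Proof.
move=> dV pV; elim: l => [|[i j] l [V' [dV' pV' V'V sepV']]].
  by exists V; split=> // i.
have [<-|nij] := eqVneq i j.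
  exists V'; split=> // k m x y; rewrite in_cons => /orP[/eqP[-> ->]|].
    by rewrite eqxx.
  exact: sepV'.
have [A [B [[dA dB] [pA pB] [AV BV] AB]]] :=
  pos_split n (dV' i) (dV' j) (pV' i) (pV' j).
pose V'' k := if k == i then A else if k == j then B else V' k.
have V''V k : V'' k `<=` V' k.
  rewrite /V''; case: eqP => [->//|_]; by case: eqP => [->|_].
exists V''; split=> [k|k|k|k m x y].
- by rewrite /V''; case: ifP => // _; case: ifP.
- by rewrite /V''; case: ifP => // _; case: ifP.
- exact: subset_trans (V''V k) (V'V k).
- rewrite in_cons => /orP[/eqP[-> ->] _ Yx Yy|kml km Yx Yy /V''V Vx /V''V Wy].
    by rewrite /V'' eqxx eq_sym (negbTE nij) eqxx; exact: AB.
  exact: sepV' kml km Yx Yy Vx Wy.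
Qed.

Lemma cantor_scheme : exists x : (nat -> bool) -> T,
  (forall e, Y (x e)) /\ forall e e' n, U n (x e) (x e') -> e = e'.
Proof.
pose good (V : seq bool -> set T) := (forall i, def (V i)) /\ (forall i, pos (V i)).
pose strings n : seq (seq bool) := [seq val t | t : n.-tuple bool].
(* Strings carry their newest bit at the head, so [behead s] is the parent of [s]. The sets are
   indexed by all strings, but only those of length [p.1] need to be separated. *)
have /choice[next nextP] (p : nat * (seq bool -> set T)) :
    exists V', good p.2 -> [/\ good V', forall s, V' s `<=` p.2 (behead s) &
      forall s t x y, size s = p.1 -> size t = p.1 -> s != t -> Y x -> Y y ->
        V' s x -> V' t y -> ~ U p.1 x y].
  have [[dV pV]|N] := pselect (good p.2); last by exists p.2.
  have [V' [dV' pV' V'V sep]] := @separate _ (p.2 \o behead) p.1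
    [seq (s, t) | s <- strings p.1, t <- strings p.1]
    (fun s => dV (behead s)) (fun s => pV (behead s)).
  have mems (s : seq bool) : size s = p.1 -> s \in strings p.1.
    by move=> /eqP ss; apply/mapP; exists (Tuple ss) => //; rewrite mem_enum.
  exists V' => _; split=> // s t x y ss st; apply: sep.
  by apply/allpairsP; exists (s, t); split=> //; exact: mems.
pose V := fix V n := if n is n'.+1 then next (n, V n') else fun=> setT.
have Vgood n : good (V n).
  by elim: n => [|n IH] //=; have [] := nextP (n.+1, V n) IH.
pose pre (e : nat -> bool) :=
  fix pre n := if n is n'.+1 then e n' :: pre n' else [::].
have size_pre e n : size (pre e n) = n by elim: n => //= n ->.
have /choice[x xP] (e : nat -> bool) : exists x, Y x /\ forall n, V n (pre e n) x.
  have [||| x Yx Vx] := pos_compact (W := fun n => V n (pre e n)).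
  - by move=> n; apply: (Vgood n).1.
  - by move=> n /=; have [_ + _] := nextP (n.+1, V n) (Vgood n); exact.
  - by move=> n; apply/posI; apply: (Vgood n).2.
  by exists x.
exists x; split=> [e|e e' n Un]; first by case: (xP e).
have [Yx Vx] := xP e; have [Yx' Vx'] := xP e'.
(* [U] increases on [Y] and level [k] separates for [U k], so [U n] between the two points forces
   equal prefixes at every level beyond [n]. *)
have Ule m : U (n + m) (x e) (x e').
  by elim: m => [|m IH]; rewrite ?addn0 // addnS; exact: U_mono.
have pre_eq m : pre e (n + m).+1 = pre e' (n + m).+1.
  apply: contrapT => /eqP npre.
  have [_ _ sep] := nextP ((n + m).+1, V (n + m)) (Vgood _).
  have := Ule m.+1; rewrite addnS.
  exact: (sep _ _ _ _ (size_pre _ _) (size_pre _ _) npre Yx Yx'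
           (Vx (n + m).+1) (Vx' (n + m).+1)).
have pre_sub a b : pre e (a + b) = pre e' (a + b) -> pre e b = pre e' b.
  by elim: a => [//|a IH] /= [_ /IH].
apply/funext => k; have := pre_eq k; by rewrite -addnS => /pre_sub[].

Qed.

End CantorScheme.

(** * Splitting positive sets by neighbourhoods *)

Section Splitting.
Variables (T : Type) (Y C : set T) (G : set (T -> T)).
Variables (U : nat -> T -> T -> Prop) (N : nat -> set (T -> T -> Prop)).
Hypothesis NU : forall m x y, U m x y <-> forall D, N m D -> D x y.
Hypothesis N_sym : forall m D, N m D ->
  exists2 D', N m D' & forall x y, D' x y -> D x y /\ D y x.
Hypothesis N_comp : forall m D, N m.+1 D -> exists2 D', N m D' &
  forall x y z, Y x -> Y y -> Y z -> D' x y -> D' y z -> D x z.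
Hypothesis N_inv : forall m D s x y, G s -> N m D -> D (s x) (s y) <-> D x y.
Hypothesis U_refl : forall x, Y x -> U 0 x x.
Hypothesis U_comp : forall m x y z, Y x -> Y y -> Y z ->
  U m x y -> U m y z -> U m.+1 x z.
Hypotheses (CY : C `<=` Y)
  (GC : forall s c, G s -> C c -> C (s c))
  (Gtrans : forall a b, C a -> C b -> exists2 s, G s & s a = b)
  (GU : forall s, G s -> exists n, forall c, C c -> U n c (s c)).
(** The form in which boundedness of [E] is used: if the ideal [Q] omits [Y], some point of [Y] has,
    at some order, no neighbourhood in [Q]. *)
Hypothesis cover : forall Q : set (set T), Q set0 ->
  (forall V W Z, Q V -> Q W -> Y `&` Z `<=` V `|` W -> Q Z) ->
  (forall c m, Y c -> exists2 D, N m D & Q (D c)) -> Q Y.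
Hypothesis unbounded : ~ exists n, forall c c', C c -> C c' -> U n c c'.

(** Composing with the pair [(y, y)] raises the order by one; this pair itself climbs from [U 0] in
    the same way, hence the conjunction in the induction. *)
Lemma U_mono_add m n x y : Y x -> Y y -> U m x y -> U (n + m) x y.
Proof.
move=> Yx Yy Uxy; suff [//] : U (n + m) x y /\ U (n + m) y y.
elim: n => [|n [IHx IHy]].
  split=> //; elim: m {Uxy} => [|m IH]; first exact: U_refl.
  exact: (U_comp Yy Yy Yy IH IH).
by split; [exact: U_comp IHx IHy|exact: (U_comp Yy Yy Yy IHy IHy)].
Qed.

Lemma U_mono m n x y : m <= n -> Y x -> Y y -> U m x y -> U n x y.
Proof. by move=> /subnK <-; exact: U_mono_add. Qed.

(** [U m] is known to lie in [U m.+1] only on [Y], so [D] itself need not have order [m]. The factor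
    [D'] of [D] does, and [D' y y] absorbs the second step. *)
Lemma N_mono m D : N m.+1 D ->
  exists2 D', N m D' & forall x y, Y x -> Y y -> D' x y -> D x y.
Proof.
move=> /N_comp[D' ND' D'D]; exists D' => // x y Yx Yy D'xy.
apply: (D'D x y y) => //; apply: (NU m y y).1 ND'.
by apply: (@U_mono 0) => //; exact: U_refl.
Qed.

Lemma N_mono_le m n D : m <= n -> N n D ->
  exists2 D', N m D' & forall x y, Y x -> Y y -> D' x y -> D x y.
Proof.
move=> /subnK <-; elim: (n - m) D => [|k IH] D; first by exists D.
move=> /N_mono[D' /IH[D'' ND'' D''D'] D'D]; exists D'' => // x y Yx Yy.
by move=> /D''D' => /(_ Yx Yy); exact: D'D.
Qed.

Section Ideal.
Variable I : set (set T).
Hypotheses (I_inv : invariant_family G I) (I_proper : ~ null C I C).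
Hypothesis I_max : forall V, ~ null C I V ->
  null C (I `|` [set W | exists2 s, G s & W = s @^-1` V]) C.

Let pos V := ~ null C I V.

(* Otherwise [Q Z := null (V `&` Z)] is an ideal to which [cover] applies. *)
Lemma pos_near V : pos V -> exists c m, Y c /\
  forall D, N m D -> pos (V `&` D c).
Proof.
move=> pV; apply: contrapT => NV; apply: (pV).
suff : null C I (V `&` Y) by move/null_le; apply=> x [/CY].
apply: (cover (Q := fun Z => null C I (V `&` Z))).
- by apply: null_disjoint => x [_ []].
- move=> W W' Z IW IW' ZWW'; apply: null_setU IW IW' _ => x [Cx [Vx Zx]].
  by case: (ZWW' x); [split=> //; exact: CY|left|right].
- move=> c m Yc; apply: contrapT => NQ; apply: NV; exists c, m; split=> // D ND ID.
  by apply: NQ; exists D.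
Qed.

(* By maximality finitely many translates of [V] cover [C] up to a null set, and
   each translation moves the points of [C] by a bounded amount. *)
Lemma null_bounded V c n : Y c -> pos V ->
  (forall D, N n D -> null C I (V `\` D c)) ->
  exists n', forall D, N n' D -> null C I (C `\` D c).
Proof.
move=> Yc /I_max + Vc.
(* Induction on the derivation that [C] becomes null, with the covered set generalized to [Z]. *)
move: {2 4}C => Z; elim=> {Z} [Z CZ|Z [IZ|[s Gs ->]]|Z1 Z2 Z _ [n1 b1] _ [n2 b2] ZZ].
- by exists 0 => D _; apply: null_disjoint => x [Cx [Zx _]]; apply: (CZ x).
- by exists 0 => D _; apply: null_le (null_gen _ IZ) _ => x [_ []].
- have [m sm] := GU Gs; pose k := maxn n m.
  (* Off a null set [s x] is near [c] at order [n], and [x] is related to [s x] by [U m]; composing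
     at the order [k] of both costs one more. *)
  exists k.+1 => D /N_comp[D' /N_sym[D1 ND1 D1D'] D'D].
  have [D2 ND2 D2D1] := N_mono_le (leq_maxl n m) ND1.
  apply: null_le (null_preimage GC I_inv Gs (Vc _ ND2)) _.
  move=> x [Cx [Vsx NDx]]; split=> // D2csx; apply: NDx.
  have Csx := GC Gs Cx; have Ysx := CY Csx; have Yx := CY Cx.
  apply: (D'D c (s x) x) => //.
    by apply: (D1D' _ _ _).1; exact: D2D1.
  apply: (D1D' _ _ _).2; apply: (NU k x (s x)).1 ND1.
  by apply: U_mono (sm _ Cx); rewrite ?leq_maxr.
- exists (maxn n1 n2) => D ND.
  have [D1 ND1 D1D] := N_mono_le (leq_maxl n1 n2) ND.
  have [D2 ND2 D2D] := N_mono_le (leq_maxr n1 n2) ND.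
  apply: null_setU (b1 _ ND1) (b2 _ ND2) _ => x [Cx [Zx NDx]].
  have Yx := CY Cx.
  case: (ZZ x) => // Zix; [left|right]; split=> // Dx; apply: NDx.
    exact: D1D.
  exact: D2D.
Qed.

Lemma pos_unbounded V c n : Y c -> pos V ->
  exists2 D, N n D & pos (V `\` D c).
Proof.
move=> Yc pV; apply: contrapT => NV.
have [n' Cc] : exists n', forall D, N n' D -> null C I (C `\` D c).
  apply: (null_bounded (n := n) Yc pV) => D ND; apply: contrapT => pD.
  by apply: NV; exists D.
(* Transitivity and invariance replace the centre [c], which may lie outside
   [C], by an arbitrary point of [C]. *)
have Ca a D : C a -> N n'.+1 D -> null C I (C `\` D a).
  move=> ca /[dup] ND /N_comp[D' /N_sym[D1 ND1 D1D'] D'D].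
  have [b [Cb D1cb]] : exists b, C b /\ D1 c b.
    apply: contrapT => Nb; apply: I_proper.
    apply: null_le (Cc _ ND1) _ => x [Cx _].
    by split=> // D1x; apply: Nb; exists x.
  have [s Gs sab] := Gtrans ca Cb.
  apply: null_le (null_preimage GC I_inv Gs (Cc _ ND1)) _ => x [Cx [_ NDx]].
  have Csx := GC Gs Cx; split=> // D1csx; apply: NDx.
  apply/(N_inv _ _ Gs ND); rewrite sab.
  have [_ D'bc] := D1D' _ _ D1cb; have [D'csx _] := D1D' _ _ D1csx.
  exact: D'D (CY Cb) Yc (CY Csx) D'bc D'csx.
(* Almost all of [C] is near [a] and near [b] at order [n'.+1], so properness gives a common
   neighbour [x], and composing through [x] costs one order. *)
apply: unbounded; exists n'.+2 => a b ca cb.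
apply/NU => D /N_comp[D' /N_sym[D1 ND1 D1D'] D'D].
apply: contrapT => NDab; apply: I_proper.
apply: null_setU (Ca _ _ ca ND1) (Ca _ _ cb ND1) _ => x [Cx _].
apply: contrapT => /not_orP[Na Nb]; apply: NDab.
have D1ax : D1 a x by apply: contrapT => h; apply: Na.
have D1bx : D1 b x by apply: contrapT => h; apply: Nb.
have [D'ax _] := D1D' _ _ D1ax; have [_ D'xb] := D1D' _ _ D1bx.
exact: D'D (CY ca) (CY Cx) (CY cb) D'ax D'xb.
Qed.

(** [D'] is chosen first, at an order above both [m] and [n], and [D] refines a factor of it: a
    [U n] step from a point of [D c] then stays inside [D' c]. *)
Lemma pos_split V W n : pos V -> pos W ->
  exists c D D', [/\ Y c, exists m, N m D, exists m, N m D', 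
    pos (V `&` D c) /\ pos (W `\` D' c)
    & forall x y, Y x -> Y y -> D c x -> ~ D' c y -> ~ U n x y].
Proof.
move=> /pos_near[c [m [Yc Vc]]] pW; pose k := maxn m n.
have [D' ND' WD'] := pos_unbounded k.+1 Yc pW.
have [D1 ND1 D1D'] := N_comp ND'.
have [D ND DD1] := N_mono_le (leq_maxl m n) ND1.
exists c, D, D'; split=> //; [by exists m|by exists k.+1|by split=> //; exact: Vc|].
move=> x y Yx Yy Dcx ND'cy Uxy; apply: ND'cy; apply: (D1D' c x y) => //.
  exact: DD1.
by apply: (NU k x y).1 ND1; apply: U_mono Uxy; rewrite ?leq_maxr.
Qed.

End Ideal.
End Splitting.

(** * Definable sets and compactness *)

Lemma finite_set_ind (T : Type) (P : set T -> Prop) : P set0 ->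
  (forall A x, P A -> P (x |` A)) -> forall A, finite_set A -> P A.
Proof.
move=> P0 PU A /(finite_seqP (T := {classic T}))[s ->].
elim: s => [|x s IH]; first by rewrite (_ : [set` _] = set0) //; apply/seteqP; split.
rewrite (_ : [set` _] = x |` [set` s]); first exact: PU.
apply/seteqP; split=> y /=; rewrite in_cons; first by case/orP=> [/eqP|]; [left|right].
by case=> [->|ys]; rewrite ?eqxx ?ys ?orbT.
Qed.

Section Formulas.
Variable L : language.

Fixpoint tmap (V W : Type) (f : V -> W) (t : term L V) : term L W :=
  match t with
  | Tvar x => Tvar (f x)
  | Tfun g ts => Tfun g (fun i => tmap f (ts i))
  end.

Fixpoint fmap (V W : Type) (f : V -> W) (phi : formula L V) : formula L W :=
  match phi with
  | Fbot => Fbot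
  | Feq t u => Feq (tmap f t) (tmap f u)
  | Frel r ts => Frel r (fun i => tmap f (ts i))
  | Fimp phi psi => Fimp (fmap f phi) (fmap f psi)
  | Fall phi => Fall (fmap (omap f) phi)
  end.

Variable M : structure L.

Lemma eval_tmap (V W : Type) (f : V -> W) (v : W -> M) t :
  eval v (tmap f t) = eval (v \o f) t.
Proof.
by elim: t => [x //|g ts IH] /=; congr func_interp; apply/funext.
Qed.

Lemma sat_fmap (V W : Type) (f : V -> W) (v : W -> M) phi :
  sat v (fmap f phi) <-> sat (v \o f) phi.
Proof.
elim: phi W f v => {V} [V|V t u|V r ts|V phi IH psi IH'|V phi IH] W f v //=.
- by rewrite !eval_tmap.
- suff -> : (fun i => eval v (tmap f (ts i))) = (fun i => eval (v \o f) (ts i)) by [].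
  by apply/funext => i; exact: eval_tmap.
- by rewrite IH IH'.
- have vE a : (fun o : option W => if o is Some x then v x else a) \o omap f =
      (fun o : option V => if o is Some x then v (f x) else a).
    by apply/funext => -[].
  by split=> h a; [rewrite -vE; apply/IH|apply/IH; rewrite vE].
Qed.

Lemma bigcup_ord_finite (T : Type) n (F : 'I_n -> set T) :
  (forall i, finite_set (F i)) -> finite_set (\bigcup_i F i).
Proof. by move=> Ff; apply: bigcup_finite => //; exact: finite_finset. Qed.

Lemma eval_support (V : Type) (t : term L V) : exists F : set V, finite_set F /\
  forall v v' : V -> M, (forall x, F x -> v x = v' x) -> eval v t = eval v' t.
Proof.
elim: t => [x|g ts /choice[F FP]].
  by exists [set x]; split=> [|v v']; [exact: finite_set1|exact].
exists (\bigcup_i F i); split=> [|v v' vv'].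
  by apply: bigcup_ord_finite => i; case: (FP i).
rewrite /=; congr func_interp; apply/funext => i.
by apply: (FP i).2 => x Fx; apply: vv'; exists i.
Qed.

(** The type of variables may be infinite. Finite support reduces quantification over a set of
    variables, and the extension of partial assignments, to finitely many coordinates. *)
Lemma sat_support (V : Type) (phi : formula L V) :
  exists F : set V, finite_set F /\
    forall v v' : V -> M, (forall x, F x -> v x = v' x) ->
      sat v phi <-> sat v' phi.
Proof.
elim: phi => {V} [V|V t u|V r ts|V phi [F [Ff FP]] psi [F' [Ff' FP']]|
  V phi [F [Ff FP]]].
- by exists set0; split=> //; exact: finite_set0.
- have [F [Ff FP]] := eval_support t; have [F' [Ff' FP']] := eval_support u.
  exists (F `|` F'); split=> [|v v' vv' /=]; first by rewrite finite_setU.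
  by rewrite (FP v v') ?(FP' v v') // => x Fx; apply: vv'; [right|left].
- have /choice[F FP] i := eval_support (ts i).
  exists (\bigcup_i F i); split=> [|v v' vv' /=].
    by apply: bigcup_ord_finite => i; case: (FP i).
  rewrite (_ : (fun i => eval v (ts i)) = (fun i => eval v' (ts i))) //.
  by apply/funext => i; apply: (FP i).2 => x Fx; apply: vv'; exists i.
- exists (F `|` F'); split=> [|v v' vv' /=]; first by rewrite finite_setU.
  by rewrite (FP v v') ?(FP' v v') // => x Fx; apply: vv'; [right|left].
- exists [set x | F (Some x)]; split=> [|v v' vv' /=].
    by apply: (finite_preimage (f := Some)) Ff => x y _ _ [].
  by split=> h a; move: (h a); apply: (FP _ _ _).1 => -[x|] //= Fx; rewrite vv'.
Qed.

Definition Fex (V : Type) (u : V) (phi : formula L V) : formula L V :=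
  Fnot (Fall (Fnot (fmap (fun w => if `[< w = u >] then None else Some w) phi))).

Lemma sat_ex (V : Type) (u : V) (v : V -> M) phi : sat v (Fex u phi) <->
  exists a, sat (fun w => if `[< w = u >] then a else v w) phi.
Proof.
have vE a : (fun o : option V => if o is Some x then v x else a) \o
    (fun w => if `[< w = u >] then None else Some w) =
    (fun w => if `[< w = u >] then a else v w).
  by apply/funext => w /=; case: asboolP.
split=> [nh|[a h]] /=.
  apply: contrapT => /forallNP N; apply: nh => a /sat_fmap.
  by rewrite vE; exact: N.
by move=> /(_ a); apply; apply/sat_fmap; rewrite vE.
Qed.

(** Only the finitely many variables of [Z] in the support of [phi] have to be quantified, one after
    another. *)
Lemma sat_project (V : Type) (Z : set V) (phi : formula L V) :
  exists psi, forall v : V -> M, sat v psi <->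
    exists2 v' : V -> M, (forall u, ~ Z u -> v' u = v u) & sat v' phi.
Proof.
have [F [Ff FP]] := sat_support phi.
have [psi psiP] : exists psi, forall v : V -> M, sat v psi <->
    exists2 v' : V -> M, (forall u, ~ (F `&` Z) u -> v' u = v u) & sat v' phi.
  elim/finite_set_ind: (F `&` Z) / (finite_setIl Z Ff) => [|A u [psi psiP]].
    exists phi => v; split=> [h|[v' vv' h]]; first by exists v.
    by rewrite (_ : v = v') //; apply/funext => u; rewrite vv'.
  exists (Fex u psi) => v; split=> [/sat_ex[a /psiP[v' vv' h]]|[v' vv' h]].
    exists v' => // w Aw; rewrite vv' => [|?]; last by apply: Aw; right.
    by case: asboolP => // wu; case: Aw; left.
  apply/sat_ex; exists (v' u); apply/psiP; exists v' => // w Aw.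
  by case: asboolP => [->//|wu]; apply: vv' => -[].
exists psi => v; split=> [/psiP[v' vv' h]|[v' vv' h]].
  by exists v' => // u Zu; apply: vv' => -[].
apply/psiP; exists (fun u => if `[< (F `&` Z) u >] then v' u else v u) => [u FZu|].
  by case: asboolP.
apply: (FP _ _ _).1 h => u Fu; case: asboolP => // FZu.
by apply: vv' => Zu; apply: FZu.
Qed.

End Formulas.

(** * Definable sets, and compactness in many variables from saturation in one *)

Section Definable.
Variables (L : language) (M : structure L).

Definition definable (B : set M) (J : Type) (W : set (J -> M)) :=
  exists phi : formula L (J + B), W = [set x | sat_param x phi].

Definition with_params (J : Type) (B : set M) (x : J -> M) (z : J + B) : M :=
  match z with inl j => x j | inr b => \val b end.

Lemma sat_paramE (J : Type) (B : set M) (x : J -> M) (phi : formula L (J + B)) :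
  sat_param x phi = sat (with_params x) phi.
Proof. by []. Qed.

Definition widen_params (J : Type) (B B' : set M) (BB' : B `<=` B')
    (z : J + B) : J + B' :=
  match z with
  | inl j => inl j
  | inr b => inr (SigSub (mem_set (BB' _ (set_mem (valP b)))))
  end.

Lemma definable_widen (J : Type) (B B' : set M) (W : set (J -> M)) :
  B `<=` B' -> definable B W -> definable B' W.
Proof.
move=> BB' [phi ->]; exists (fmap (widen_params BB') phi).
apply/seteqP; split=> x /=; rewrite !sat_paramE sat_fmap;
  by rewrite (_ : _ \o _ = with_params x) //; apply/funext => -[].
Qed.

Lemma definableT (J : Type) (B : set M) : definable B [set: J -> M].
Proof. by exists (Fnot Fbot); apply/seteqP; split=> // x _ []. Qed.

Lemma definableC (J : Type) (B : set M) (W : set (J -> M)) :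
  definable B W -> definable B (~` W).
Proof. by move=> [phi ->]; exists (Fnot phi). Qed.

Lemma definableI (J : Type) (B : set M) (W W' : set (J -> M)) :
  definable B W -> definable B W' -> definable B (W `&` W').
Proof.
move=> [phi ->] [psi ->]; exists (Fnot (Fimp phi (Fnot psi))).
apply/seteqP; split=> x /=; first by move=> [h h'] /(_ h h').
by move=> h; split; apply: contrapT => N; apply: h.
Qed.

Lemma definable_reindex (J J' : Type) (h : J -> J') (B : set M)
    (W : set (J -> M)) :
  definable B W -> definable B [set x : J' -> M | W (x \o h)].
Proof.
move=> [phi ->].
pose f (z : J + B) : J' + B :=
  match z with inl j => inl (h j) | inr b => inr b end.
exists (fmap f phi).
apply/seteqP; split=> x /=; rewrite !sat_paramE sat_fmap;
  by rewrite (_ : _ \o _ = with_params (x \o h)) //; apply/funext => -[].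
Qed.

Definition pair_fun (J : Type) (x y : J -> M) (z : J + J) : M :=
  match z with inl j => x j | inr j => y j end.

(** Only the coordinates of [c] in the support of the formula become parameters, which keeps [B]
    finite; the others may be sent to any variable. *)
Lemma definable_section (J : Type) (W : set (J + J -> M)) (c : J -> M) :
  definable set0 W ->
  exists2 B : set M, finite_set B & definable B [set x | W (pair_fun c x)].
Proof.
move=> [phi ->]; have [F [Ff FP]] := sat_support M phi.
pose F' := [set j | F (inl (inl j))].
have F'f : finite_set F'.
  by apply: (finite_preimage (f := inl \o inl)) Ff => x y _ _ [].
exists (c @` F'); first exact: finite_image.
have mem j : F' j -> c j \in c @` F' by move=> Fj; apply/mem_set; exists j.
pose f (z : (J + J) + (set0 : set M)) : J + (c @` F') :=
  match z with
  | inl (inl j) =>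
    if pselect (F' j) is left Fj then inr (SigSub (mem j Fj)) else inl j
  | inl (inr j) => inl j
  | inr a => False_rect _ (set_mem (valP a))
  end.
exists (fmap f phi).
apply/seteqP; split=> x /=; rewrite !sat_paramE sat_fmap;
  apply: (FP _ _ _).1 => -[[j|j]|a] Fj //=.
- by case: pselect.
- by case: (set_mem (valP a)).
- by case: pselect.
- by case: (set_mem (valP a)).
Qed.

Definition directed (J : Type) (F : set (set J)) :=
  F !=set0 /\ forall V W, F V -> F W -> exists2 Z, F Z & Z `<=` V `&` W.

Variable K : Type.
Hypotheses (natK : small K [set: nat]) (M_sat : saturated M K).

Section Compactness.
Variables (J : Type) (B : set M) (F : set (set (J -> M))).
Hypotheses (Jsmall : small K [set: J]) (Bsmall : small K B).
Hypotheses (Fdef : forall W, F W -> definable B W) (Fdir : directed F)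
  (F0 : forall W, F W -> W !=set0).

(** [R] is a partial point of [J -> M] given by its graph; a maximal consistent one is total and is
    the point sought. *)
Let agrees (R : set (J * M)) (x : J -> M) := forall j m, R (j, m) -> x j = m.
Let consistent (R : set (J * M)) := forall W, F W -> exists2 x, W x & agrees R x.

(** The formula of [W] sees finitely many coordinates, whose values already occur in one member of
    the chain; overwriting the other coordinates does not affect it. *)
Lemma consistent_chain (H : set (set (J * M))) : H `<=` consistent ->
  total_on H subset -> consistent (\bigcup_(R in H) R).
Proof.
move=> Hc Htot W FW; pose S := \bigcup_(R in H) R.
have [phi Wphi] := Fdef FW; have [D [Df DP]] := sat_support M phi.
have Sfun j m m' : S (j, m) -> S (j, m') -> m = m'.
  move=> [R HR Rm] [R' HR' Rm'].
  have [R'' HR'' [Rm1 Rm1']] : exists2 R'', H R'' & R'' (j, m) /\ R'' (j, m').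
    by case: (Htot _ _ HR HR') => [/(_ _ Rm)|/(_ _ Rm')]; [exists R'|exists R].
  by have [x _ xR] := Hc _ HR'' _ FW; rewrite -(xR _ _ Rm1) -(xR _ _ Rm1').
have [R Rc RS] : exists2 R, consistent R &
    forall j m, D (inl j) -> S (j, m) -> R (j, m).
  pose D' := [set j | D (inl j)].
  have D'f : finite_set D'.
    by apply: (finite_preimage (f := inl)) Df => x y _ _ [].
  (* The empty assignment starts the induction, as [H] may be empty. *)
  suff [R HR RD] : exists2 R, (set0 |` H) R &
      forall j m, D' j -> S (j, m) -> R (j, m).
    exists R => //; case: HR => [->|/Hc//] V FV.
    by have [x Vx] := F0 FV; exists x => // ? ?.
  elim/finite_set_ind: D' / D'f => [|A j [R HR RA]].
    by exists set0 => //; left.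
  have [[m [R' HR' R'm]]|N] := pselect (exists m, S (j, m)); last first.
    by exists R => // j' m [->|Aj'] Sm; [case: N; exists m|exact: RA].
  have [Z [HZ RZ R'Z]] : exists Z, [/\ H Z, R `<=` Z & R' `<=` Z].
    case: HR => [->|HR]; first by exists R'; split=> //; exact: sub0set.
    by case: (Htot _ _ HR HR'); [exists R'; split|exists R; split].
  exists Z => [|j' m' [->|Aj'] Sm']; [by right| |exact/RZ/RA].
  by apply: R'Z; rewrite -(Sfun j m m') //; exists R'.
have [x Wx xR] := Rc _ FW.
have /choice[y yP] j : exists m, (forall m', S (j, m') -> m = m') /\
    ((exists m', S (j, m')) \/ m = x j).
  have [[m Sm]|N] := pselect (exists m, S (j, m)).
    by exists m; split=> [m'|]; [exact: Sfun|left; exists m].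
  by exists (x j); split=> [m' Sm'|]; [case: N; exists m'|right].
exists y => [|j m /(yP j).1 //].
move: Wx; rewrite Wphi /= !sat_paramE; apply: (DP _ _ _).1 => -[j|b] //= Dj.
have [ym [[m Sm]|->//]] := yP j.
by rewrite (ym _ Sm) (xR _ _ (RS _ _ Dj Sm)).
Qed.

(** Saturation realizes the one-variable type [p] of all that some [W] together with [R] forces on
    coordinate [j]; directedness of [F] makes [p] finitely satisfiable. *)
Lemma consistent_extend (R : set (J * M)) j : consistent R ->
  exists m, consistent ((j, m) |` R).
Proof.
move=> Rc; have [m0] := carrier_inhabited M.
have [[m Rm]|NR] := pselect (exists m, R (j, m)).
  by exists m; rewrite setUidr // => _ ->.
have Rfun i m m' : R (i, m) -> R (i, m') -> m = m'.
  move=> Rm Rm'; have [[W FW] _] := Fdir; have [x _ xR] := Rc _ FW.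
  by rewrite -(xR _ _ Rm) -(xR _ _ Rm').
have /choice[g gP] i : exists m, forall m', R (i, m') -> R (i, m).
  have [[m Rm]|N] := pselect (exists m, R (i, m)); first by exists m.
  by exists m0 => m' Rm'; case: N; exists m'.
pose A := B `|` range g.
have Asmall : small K A.
  exact: (small_setU natK Bsmall (small_image g Jsmall)).
have gA i : g i \in A by apply/mem_set; right; exists i.
have BA : B `<=` A by move=> b; left.
pose p : set (formula L (unit + A)) := [set phi | exists2 W, F W &
  forall x, W x -> agrees R x -> sat_param (fun=> x j) phi].
have [m mp] : exists m : M, forall phi, p phi -> sat_param (fun=> m) phi.
  apply: M_sat => // q qp qfin.
  suff [W FW Wq] : exists2 W, F W & forall phi, q phi -> forall x, W x ->
      agrees R x -> sat_param (fun=> x j) phi.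
    by have [x Wx xR] := Rc _ FW; exists (x j) => phi qphi; exact: (Wq phi).
  elim/finite_set_ind: q / qfin qp => [_|q' phi IH q'p].
    by have [[W FW] _] := Fdir; exists W.
  have [|W FW Wq'] := IH; first by move=> psi q'psi; apply: q'p; right.
  have [|W' FW' Wphi] := q'p phi; first by left.
  have [Z FZ ZWW'] := Fdir.2 _ _ FW FW'.
  exists Z => // psi [->|q'psi] x /ZWW'[Wx W'x]; [exact: Wphi|exact: Wq'].
exists m => W FW.
have [phi Wphi] := Fdef FW.
(* Unassigned coordinates other than [j] are quantified out; [f] turns assigned ones into parameters
   and leaves [j] as the only variable. The resulting formula belongs to [p]. *)
pose Z : set (J + B) :=
  [set u | exists i, [/\ u = inl i, ~ (exists m, R (i, m)) & i <> j]].
have [psi psiP] := sat_project M Z phi.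
pose f (u : J + B) : unit + A :=
  match u with
  | inl i => if `[< exists m, R (i, m) >] then inr (SigSub (gA i)) else inl tt
  | inr b => widen_params BA (inr b)
  end.
have fP a : sat_param (fun=> a) (fmap f psi) <->
    exists2 x, W x & agrees R x /\ x j = a.
  rewrite sat_paramE sat_fmap psiP Wphi; split=> [[v vE h]|[x h [xR xj]]].
    exists (fun i => v (inl i)) => /=.
      rewrite sat_paramE (_ : with_params _ = v) //.
      by apply/funext => -[i|b] //=; rewrite vE //= => -[i []].
    split=> [i a' Ra'|].
      rewrite vE /=; last by move=> [_ [[<-]] /(_ (ex_intro _ a' Ra'))].
      case: asboolP => [_|[]]; last by exists a'.
      exact: Rfun (gP _ _ Ra') Ra'.
    rewrite vE /=; first by case: asboolP.
    by move=> [_ [[<-]]].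
  exists (with_params x) => // -[i|b] //= Zi.
  case: asboolP => [[a' Ra']|N] /=; first by rewrite (xR _ _ (gP _ _ Ra')).
  rewrite -xj; congr x; apply: contrapT => ij; apply: Zi.
  by exists i.
have /fP[x Wx [xR xj]] : sat_param (fun=> m) (fmap f psi).
  by apply: mp; exists W => // x Wx xR; apply/fP; exists x.
by exists x => // i a [[-> ->]|/xR].
Qed.

Lemma compactness : exists x, forall W, F W -> W x.
Proof.
have [R Rc Rmax] := Zorn_maximal consistent_chain.
have /choice[x xR] j : exists m, R (j, m).
  have [m mc] := consistent_extend j Rc; exists m.
  by apply: Rmax mc _ _ => [p|]; [right|left].
exists x => W FW; have [y Wy yR] := Rc _ FW.
rewrite (_ : x = y) //.
by apply/funext => j; rewrite (yR _ _ (xR j)).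
Qed.

End Compactness.
End Definable.

Section Automorphism.
Variables (L : language) (M : structure L) (s : M -> M).
Hypothesis s_aut : automorphism s.

Lemma eval_automorphism (V : Type) (v : V -> M) (t : term L V) :
  eval (s \o v) t = s (eval v t).
Proof.
have [_ sf _] := s_aut; elim: t => [x //|f ts IH] /=; rewrite sf.
by congr func_interp; apply/funext.
Qed.

Lemma sat_automorphism (V : Type) (v : V -> M) (phi : formula L V) :
  sat (s \o v) phi <-> sat v phi.
Proof.
have [[s' s'K sK'] _ sp] := s_aut.
elim: phi v => {V} [V|V t u|V r ts|V phi IH psi IH'|V phi IH] v //=.
- by rewrite !eval_automorphism; split=> [/(can_inj s'K)|->].
- rewrite (_ : (fun i => eval (s \o v) (ts i)) = s \o (fun i => eval v (ts i))).
    exact: sp.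
  by apply/funext => i; exact: eval_automorphism.
- by rewrite IH IH'.
- have vE a : (fun o : option V => if o is Some x then (s \o v) x else s a) =
      s \o (fun o : option V => if o is Some x then v x else a).
    by apply/funext => -[].
  split=> h a; first by apply/IH; rewrite -vE.
  by rewrite -[a]sK' vE; apply/IH.
Qed.

Lemma definable_automorphism (J : Type) (W : set (J -> M)) x :
  definable set0 W -> W (s \o x) <-> W x.
Proof.
move=> [phi ->] /=; rewrite !sat_paramE -(sat_automorphism (with_params x)).
rewrite (_ : with_params (s \o x) = s \o with_params x) //.
by apply/funext => -[//|b]; case: (set_mem (valP b)).
Qed.

End Automorphism.

(** * Closed sets and definable neighbourhoods of the normal form *)

Section Closed.
Variables (L : language) (M : structure L) (K : Type).
Hypotheses (natK : small K [set: nat]) (M_sat : saturated M K).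

(** Closedness in the topology generated by the [B]-definable sets: type definability without
    mention of formulas. *)
Definition closed_over (B : set M) (J : Type) (Y : set (J -> M)) :=
  forall x, (forall P, definable B P -> Y `<=` P -> P x) -> Y x.

Lemma closed_over_widen (J : Type) (B B' : set M) (Y : set (J -> M)) :
  B `<=` B' -> closed_over B Y -> closed_over B' Y.
Proof. by move=> BB' Yc x xP; apply: Yc => P /(definable_widen BB'); exact: xP. Qed.

Lemma type_definable_closed (J : Type) (B : set M) (Y : set (J -> M)) :
  type_definable B Y -> closed_over B Y.
Proof.
move=> [p ->] x xP phi pphi; apply: (xP [set x | sat_param x phi]).
  by exists phi.
by move=> y; exact.
Qed.

Lemma compactness_on (J : Type) (B : set M) (Y : set (J -> M))
    (F : set (set (J -> M))) :
  small K [set: J] -> small K B -> closed_over B Y ->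
  (forall W, F W -> definable B W) -> directed F ->
  (forall W, F W -> Y `&` W !=set0) ->
  exists2 x, Y x & forall W, F W -> W x.
Proof.
move=> Js Bs Yc Fdef [[W0 FW0] Fdir] YF.
pose F' := [set V | exists P W, [/\ definable B P, Y `<=` P, F W & V = P `&` W]].
have [|||x xF'] := @compactness _ _ _ natK M_sat _ B F' Js Bs.
- by move=> _ [P [W [dP _ FW ->]]]; apply: definableI => //; exact: Fdef.
- split; first by exists (setT `&` W0), setT, W0; split=> //; exact: definableT.
  move=> _ _ [P [W [dP YP FW ->]]] [P' [W' [dP' YP' FW' ->]]].
  have [Z FZ ZWW'] := Fdir _ _ FW FW'.
  exists ((P `&` P') `&` Z).
    exists (P `&` P'), Z; split=> //; first exact: definableI.
    by rewrite subsetI.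
  by move=> x [[Px P'x] /ZWW'[Wx W'x]].
- move=> _ [P [W [_ YP FW ->]]]; have [x [Yx Wx]] := YF _ FW.
  by exists x; split=> //; exact: YP.
exists x => [|W FW].
  by apply: Yc => P dP YP; have [] : (P `&` W0) x by apply: xF'; exists P, W0.
have [] // : (setT `&` W) x.
by apply: xF'; exists setT, W; split=> //; exact: definableT.
Qed.

(** With finite parameter sets, the parameters of a small family of such sets again form a small set
    by [small_bigcup]. *)
Definition finitely_definable (J : Type) (W : set (J -> M)) :=
  exists2 B : set M, finite_set B & definable B W.

Lemma common_parameters (I J : Type) (B : set M) (W : I -> set (J -> M)) :
  small K [set: I] -> small K B -> (forall i, finitely_definable (W i)) ->
  exists B', [/\ small K B', B `<=` B' & forall i, definable B' (W i)].
Proof.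
move=> Is Bs Wd.
have /choice[b bP] i : exists b, finite_set b /\ definable b (W i).
  by have [b] := Wd i; exists b.
exists (B `|` \bigcup_i b i); split=> [|x|i]; first 1 last.
- by left.
- by apply: definable_widen (bP i).2 => x; right; exists i.
apply: small_setU => //; apply: small_bigcup => // i.
exact/finite_set_countable/(bP i).1.
Qed.

Lemma finitely_definableT (J : Type) : finitely_definable [set: J -> M].
Proof. by exists set0; [exact: finite_set0|exact: definableT]. Qed.

Lemma finitely_definableC (J : Type) (W : set (J -> M)) :
  finitely_definable W -> finitely_definable (~` W).
Proof. by move=> [B Bf dW]; exists B => //; exact: definableC. Qed.

Lemma finitely_definableI (J : Type) (V W : set (J -> M)) :
  finitely_definable V -> finitely_definable W -> finitely_definable (V `&` W).
Proof.
move=> [B Bf dV] [B' B'f dW]; exists (B `|` B'); first by rewrite finite_setU.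
apply: definableI; first by apply: definable_widen dV; left.
by apply: definable_widen dW; right.
Qed.

Lemma decreasing_compactness (J : Type) (B : set M) (Y : set (J -> M))
    (W : nat -> set (J -> M)) :
  small K [set: J] -> small K B -> closed_over B Y ->
  (forall n, finitely_definable (W n)) -> (forall n, W n.+1 `<=` W n) ->
  (forall n, Y `&` W n !=set0) -> exists2 x, Y x & forall n, W n x.
Proof.
move=> Js Bs Yc /(common_parameters natK Bs)[B' [B's BB' dW]] Wdec YW.
have Wle m n : m <= n -> W n `<=` W m.
  move=> /subnK <-; elim: (n - m) => [//|k IH].
  by apply: subset_trans (Wdec _) IH.
have [||||x Yx xW] := @compactness_on _ B' Y (range W) Js B's.
- exact: closed_over_widen Yc.
- by move=> _ [n _ <-].
- split; first by exists (W 0), 0.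
  move=> _ _ [m _ <-] [n _ <-]; exists (W (maxn m n)); first by exists (maxn m n).
  by rewrite subsetI; split; apply: Wle; rewrite ?leq_maxl ?leq_maxr.
- by move=> _ [n _ <-].
by exists x => // n; apply: xW; exists n.
Qed.

Section Neighbourhoods.
Variables (J : Type) (U : nat -> set ((J -> M) * (J -> M))).

Definition nbhd (m : nat) : set ((J -> M) -> (J -> M) -> Prop) :=
  [set D | exists W, [/\ definable set0 W, flat (U m) `<=` W &
    D = fun x y => W (pair_fun x y)]].

Hypothesis Udef : forall m, type_definable set0 (flat (U m)).
Hypothesis Usym : forall m x y, U m (x, y) -> U m (y, x).

Lemma nbhd_inter m x y : U m (x, y) <-> forall D, nbhd m D -> D x y.
Proof.
split=> [Uxy _ [W [_ UW ->]]|UD]; first exact: UW.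
suff : flat (U m) (pair_fun x y) by [].
apply: type_definable_closed (Udef m) _ _ => W dW UW.
by apply: (UD (fun x y => W (pair_fun x y))); exists W.
Qed.

Lemma nbhd_sym m D : nbhd m D ->
  exists2 D', nbhd m D' & forall x y, D' x y -> D x y /\ D y x.
Proof.
move=> [W [dW UW ->]].
pose swap (z : J + J) : J + J :=
  match z with inl j => inr j | inr j => inl j end.
pose W' : set (J + J -> M) := W `&` [set z : J + J -> M | W (z \o swap)].
exists (fun x y => W' (pair_fun x y)).
  exists W'; split=> //; first by apply: (definableI dW); exact: definable_reindex.
  move=> z Uz; split; first exact: UW.
  by apply: UW; exact: Usym.
move=> x y [Wxy Wyx]; split=> //.
by rewrite (_ : pair_fun y x = pair_fun x y \o swap) //; apply/funext => -[].
Qed.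

Lemma nbhd_automorphism m D s x y : automorphism s -> nbhd m D ->
  D (s \o x) (s \o y) <-> D x y.
Proof.
move=> s_aut [W [dW _ ->]].
rewrite -(definable_automorphism s_aut (pair_fun x y) dW).
by rewrite (_ : pair_fun _ _ = s \o pair_fun x y) //; apply/funext => -[].
Qed.

Lemma nbhd_section m D c : nbhd m D -> finitely_definable (D c).
Proof. by move=> [W [dW _ ->]]; exact: definable_section. Qed.

Variables (B : set M) (Y : set (J -> M)).
Hypotheses (Js : small K [set: J]) (Bs : small K B) (Yc : closed_over B Y).

(** Compactness on triples: otherwise every box, built from [W'] on the two inner pairs and the
    complement of [W] on the outer pair, meets [Y3]. A point in all boxes makes two [U m] steps
    whose ends lie outside [W], against [Ucomp]. *)
Lemma nbhd_comp m D :
  (forall x y z, Y x -> Y y -> Y z ->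
     U m (x, y) -> U m (y, z) -> U m.+1 (x, z)) ->
  nbhd m.+1 D -> exists2 D', nbhd m D' &
    forall x y z, Y x -> Y y -> Y z -> D' x y -> D' y z -> D x z.
Proof.
move=> Ucomp [W [dW UW ->]]; apply: contrapT => ND.
pose J3 : Type := J + (J + J).
pose i1 : J -> J3 := inl.
pose i2 : J -> J3 := fun j => inr (inl j).
pose i3 : J -> J3 := fun j => inr (inr j).
pose i12 (z : J + J) : J3 := match z with inl j => i1 j | inr j => i2 j end.
pose i23 (z : J + J) : J3 := match z with inl j => i2 j | inr j => i3 j end.
pose i13 (z : J + J) : J3 := match z with inl j => i1 j | inr j => i3 j end.
pose Y3 := [set v : J3 -> M | [/\ Y (v \o i1), Y (v \o i2) & Y (v \o i3)]].
have Y3c : closed_over B Y3.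
  move=> v vP; split; apply: Yc => P dP YP.
  - apply: (vP [set v : J3 -> M | P (v \o i1)]); last by move=> w []/YP.
    exact: definable_reindex.
  - apply: (vP [set v : J3 -> M | P (v \o i2)]); last by move=> w [_ /YP].
    exact: definable_reindex.
  - apply: (vP [set v : J3 -> M | P (v \o i3)]); last by move=> w [_ _ /YP].
    exact: definable_reindex.
pose box W' := [set v : J3 -> M | W' (v \o i12)] `&`
  [set v : J3 -> M | W' (v \o i23)] `&` ~` [set v : J3 -> M | W (v \o i13)].
pose F : set (set (J3 -> M)) := [set V | exists W',
  [/\ definable set0 W', flat (U m) `<=` W' & V = box W']].
have J3s : small K [set: J3] by do 2 apply: small_sum => //.
have [|||v [Y1 Y2 Y3v] vF] := @compactness_on _ B Y3 F J3s Bs Y3c.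
- move=> _ [W' [dW' _ ->]]; apply: (definable_widen (@sub0set _ B)).
  by apply: definableI; [apply: definableI|apply: definableC]; exact: definable_reindex.
- split.
    exists (box setT); exists setT; split=> //; exact: definableT.
  move=> _ _ [V [dV UV ->]] [V' [dV' UV' ->]].
  exists (box (V `&` V')).
    by exists (V `&` V'); split=> //; [exact: definableI|rewrite subsetI].
  by move=> v [[[? ?] [? ?]] ?].
- move=> _ [W' [dW' UW' ->]]; apply: contrapT => N0; apply: ND.
  exists (fun x y => W' (pair_fun x y)); first by exists W'.
  move=> x y z Yx Yy Yz Wxy Wyz; apply: contrapT => NW; apply: N0.
  pose v (u : J3) : M :=
    match u with inl j => x j | inr (inl j) => y j | inr (inr j) => z j end.
  have v12 : v \o i12 = pair_fun x y by apply/funext => -[].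
  have v23 : v \o i23 = pair_fun y z by apply/funext => -[].
  have v13 : v \o i13 = pair_fun x z by apply/funext => -[].
  by exists v; split; [split|split; [split|]]; rewrite /= ?v12 ?v23 ?v13.
have U12 : U m (v \o i1, v \o i2).
  apply: type_definable_closed (Udef m) (v \o i12) _ => W' dW' UW'.
  by have [[]] := vF _ (ex_intro _ W' (And3 dW' UW' erefl)).
have U23 : U m (v \o i2, v \o i3).
  apply: type_definable_closed (Udef m) (v \o i23) _ => W' dW' UW'.
  by have [[]] := vF _ (ex_intro _ W' (And3 dW' UW' erefl)).
have [_] := vF _ (ex_intro _ setT (And3 (definableT _ _) (fun _ _ => I) erefl)).
by apply; apply: UW; exact: Ucomp U12 U23.
Qed.

(* A point of [Y] avoiding a neighbourhood of each order of a representative of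
   each [E]-class would lie in no class; boundedness makes this family small. *)
Lemma nbhd_cover (X : set (J -> M)) (E : set ((J -> M) * (J -> M)))
    (Q : set (set (J -> M))) :
  Y `<=` X -> equivalence_on X E -> E = \bigcup_m U m -> bounded K X E ->
  Q set0 -> (forall V W Z, Q V -> Q W -> Y `&` Z `<=` V `|` W -> Q Z) ->
  (forall c m, Y c -> exists2 D, nbhd m D & Q (D c)) -> Q Y.
Proof.
move=> YX [Erefl Esym Etrans] EU Ebd Q0 QU QD; apply: contrapT => NQ.
have Qle V Z : Q V -> Y `&` Z `<=` V -> Q Z.
  by move=> QV ZV; apply: (QU V V) => // x /ZV; left.
have /choice[r rP] (q : quotient X E) : exists c,
    (exists2 y, Y y & \val q y) -> Y c /\ \val q c.
  have [[y Yy qy]|N] := pselect (exists2 y, Y y & \val q y); first by exists y.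
  by have [m0] := carrier_inhabited M; exists (fun=> m0) => /N.
have /choice[V VP] (i : quotient X E * nat) : exists V,
    [/\ finitely_definable V, Q V & Y (r i.1) -> forall y, U i.2 (r i.1, y) -> V y].
  have [Yr|NYr] := pselect (Y (r i.1)); last first.
    exists set0; split=> //; rewrite -setCT.
    exact/finitely_definableC/finitely_definableT.
  have [D ND QDr] := QD _ i.2 Yr; exists (D (r i.1)); split=> //.
    exact: nbhd_section ND.
  by move=> _ y /nbhd_inter; exact.
have Is : small K [set: quotient X E * nat].
  apply: small_mul_nat => //; apply: small_le Ebd.
  by have /card_eqPle[] := card_setT (quotient X E).
have Vd i : finitely_definable (V i) by case: (VP i).
have [B' [B's BB' dV]] := common_parameters Is Bs Vd.
(* [F] is the filter dual to [Q]; it contains the complement of every [V i], so a point of [Y] in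
   all its members avoids every [V i]. *)
pose F : set (set (J -> M)) := [set W | definable B' W /\ Q (Y `\` W)].
have [||||y Yy yF] := @compactness_on _ B' Y F Js B's.
- exact: closed_over_widen Yc.
- by move=> W [].
- split=> [|W W' [dW QW] [dW' QW']].
    by exists setT; split; [exact: definableT|rewrite setDT].
  exists (W `&` W') => //; split; first exact: definableI.
  by apply: QU QW QW' _; rewrite setDIr => x [].
- move=> W [_ QW]; apply: contrapT => YW; apply/NQ/(Qle _ _ QW) => x [Yx _].
  by split=> // Wx; apply: YW; exists x.
have Xy := YX _ Yy.
have qy : quotient X E (class_of X E y) by exists y.
pose q : quotient X E := SigSub (mem_set qy).
have [|Yr [Xr Eyr]] := rP q; first by exists y => //; split=> //; exact: Erefl.
have : E (r q, y) by apply: Esym.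
rewrite EU => -[m _ Uy].
have [_ QV /(_ Yr y Uy)] := VP (q, m).
suff : (~` V (q, m)) y by [].
apply: yF; split; first by apply: definableC.
by apply: Qle QV _ => x [_ [_ /contrapT]].
Qed.

End Neighbourhoods.
End Closed.

(** * The perfect family of classes of [E] on [Y] *)

Unset Implicit Arguments.
Set Strict Implicit.
Set Printing Implicit Defensive.

Theorem theorem3p20 (L : language) (T : set (formula L void))
    (hT : complete_theory T)
    (K : Type) (M : structure L) (hM : monster M K T)
    (A : set M) (hA : small K A)
    (alpha : ordinalType) (halpha : small K [set: alpha])
    (X : set (alpha -> M)) (hX : type_definable A X)
    (E : set ((alpha -> M) * (alpha -> M)))
    (hE : invariant_Fsigma_equivalence K X E)
    (U : nat -> set ((alpha -> M) * (alpha -> M)))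
    (hU : normal_form X E U)
    (hbounded : bounded K X E)
    (C : set (alpha -> M)) (hC : quotient X E C)
    (hCU : ~ strongly_closed_on E C U)
    (Y : set (alpha -> M)) (hCY : C `<=` Y) (hYX : Y `<=` X)
    (hY : pseudo_closed K Y)
    (G : set (M -> M)) (hG : aut_subgroup G)
    (hYG : invariant_under G Y)
    (hGC : transitive_on G C)
    (hGU : forall s, G s -> exists n, forall c, C c -> U n (c, s \o c)) :
  [set: set nat] #<= quotient Y E.
Proof.
have [_ [natK _ _] M_sat _] := hM.
have [_ _ Eeq] := hE; have [Erefl Esym Etrans] := Eeq.
have [Udef EU Urefl Usym Ucomp] := hU.
have [Gaut Gid GM _] := hG.
have [B Bs /type_definable_closed Yc] := hY.
have [a Xa Ca] := hC.
have UE n x y : U n (x, y) -> E (x, y) by rewrite EU => Uxy; exists n.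
pose V n x y := U n (x, y).
pose GT : set ((alpha -> M) -> (alpha -> M)) :=
  [set t | exists2 s, G s & t = (fun x => s \o x)].
have GTid : GT id by exists id.
have GTM s t : GT s -> GT t -> GT (s \o t).
  by move=> [s' Gs ->] [t' Gt ->]; exists (s' \o t') => //; exact: GM.
(* [s c] stays in [Y] by invariance, and [U n] relates it to [c], so it stays in the class [C]. *)
have GTC s c : GT s -> C c -> C (s c).
  move=> [s' Gs ->] Cc; have [n Un] := hGU _ Gs.
  have Ysc : Y (s' \o c) by apply/hYG => //; exact: hCY.
  have Xsc := hYX _ Ysc; have Esc := UE _ _ _ (Un _ Cc).
  move: Cc; rewrite -Ca => -[Xc Eac]; split=> //.
  exact: Etrans Eac Esc.
have GTtrans x y : C x -> C y -> exists2 s, GT s & s x = y.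
  move=> Cx Cy; have [s Gs sxy] := hGC _ _ Cx Cy.
  by exists (fun x => s \o x) => //; exists s.
have GTU s : GT s -> exists n, forall c, C c -> V n c (s c).
  by move=> [s' /hGU[n Un] ->]; exists n.
have C0 : C !=set0 by exists a; rewrite -Ca; split=> //; exact: Erefl.
have VN m x y : V m x y <-> forall D, nbhd U m D -> D x y by exact: nbhd_inter.
have Vrefl x : Y x -> V 0 x x by move=> /hYX /Urefl.
have Vcomp m x y z : Y x -> Y y -> Y z -> V m x y -> V m y z -> V m.+1 x z.
  by move=> /hYX Xx /hYX Xy /hYX Xz; exact: Ucomp.
have Ninv m D s x y : GT s -> nbhd U m D -> D (s x) (s y) <-> D x y.
  by move=> [s' Gs ->]; apply: nbhd_automorphism; exact: Gaut.
have Ncomp m D : nbhd U m.+1 D -> exists2 D', nbhd U m D' &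
    forall x y z, Y x -> Y y -> Y z -> D' x y -> D' y z -> D x z.
  by apply: (nbhd_comp natK M_sat Udef halpha Bs Yc); exact: Vcomp.
have Ncover (Q : set (set (alpha -> M))) : Q set0 ->
    (forall V W Z, Q V -> Q W -> Y `&` Z `<=` V `|` W -> Q Z) ->
    (forall c m, Y c -> exists2 D, nbhd U m D & Q (D c)) -> Q Y.
  exact: (nbhd_cover natK M_sat Udef halpha Bs Yc hYX Eeq EU hbounded).
have Cunb : ~ exists n, forall c c', C c -> C c' -> V n c c'.
  move=> [n Cn]; apply: hCU; exists n.
  apply/seteqP; split=> -[c c'] [h [/= Cc Cc']].
    by split=> //; exact: Cn.
  by split=> //; exact: UE h.
have [N [Ninvar Nproper Nmax]] := maximal_invariant_ideal C0 GTid GTM.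
pose pos W := ~ null C N W.
have posI W : pos W -> Y `&` W !=set0.
  move=> pW; apply: contrapT => N0; apply: pW; apply: null_disjoint => x [Cx Wx].
  by apply: N0; exists x; split=> //; exact: hCY.
have splitP W W' n : finitely_definable W -> finitely_definable W' ->
  pos W -> pos W' ->
  exists V1 V2, [/\ finitely_definable V1 /\ finitely_definable V2,
    pos V1 /\ pos V2, V1 `<=` W /\ V2 `<=` W' &
    forall x y, Y x -> Y y -> V1 x -> V2 y -> ~ V n x y].
  move=> dW dW' pW pW'.
  have [c [D [D' [Yc' [m ND] [m' ND'] [pD pD'] DD']]]] :=
    pos_split VN (@nbhd_sym _ _ _ U Usym) Ncomp Ninv Vrefl Vcomp hCY GTC
      GTtrans GTU Ncover Cunb Ninvar Nproper Nmax n pW pW'.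
  exists (W `&` D c), (W' `\` D' c); split=> //.
  - rewrite setDE; split; apply: finitely_definableI => //.
      exact: nbhd_section ND.
    apply: finitely_definableC; exact: nbhd_section ND'.
  - by move=> x y Yx Yy [_ Dx] [_ Dy]; exact: DD'.
have [x [Yx xU]] := @cantor_scheme _ Y V (@finitely_definable _ M alpha) pos
  (finitely_definableT _ _)
  (fun TT => Nproper (null_le TT (fun _ _ => I)))
  splitP posI
  (fun W => decreasing_compactness natK M_sat halpha Bs Yc (W := W))
  (fun n x y Yx Yy => U_mono Vrefl Vcomp (leqnSn n) Yx Yy).
pose e (S : set nat) (n : nat) := `[< S n >].
apply: (@card_le_inj _ _ _ _ (fun S => class_of Y E (x (e S)))) =>
  [S _|S S' _ _ eSS'].
  by exists (x (e S)).
(* If the two classes coincide, the two points are related by some [U n], and [xU] identifies the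
   sequences. *)
have : class_of Y E (x (e S')) (x (e S')) by split=> //; exact/Erefl/hYX.
rewrite -eSS' EU => -[_ [n _ /xU eq]].
apply/funext => n'; apply/propext.
by rewrite -[S n']asboolE -[S' n']asboolE -/(e S n') eq.
Qed.
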